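(* Let $X$ and $Y$ be graphs, let $u,v$ be vertices of $X$ and let $y$ be a vertex of $Y$. Suppose $X$ admits peak state transfer from $u$ to $v$ at time $\tau$ with amount $\alpha$, and $Y$ is periodic at the vertex $y$ at time $\tau$. Then the Cartesian product $X\square Y$ admits peak state transfer from $(u,y)$ to $(v,y)$ at time $\tau$ with amount $\alpha$.
   Context: Graphs are finite and simple. For a graph $X$ with adjacency matrix $A$ and spectral decomposition $A=\sum_\theta\theta E_\theta$ (sum over distinct eigenvalues, $E_\theta$ the orthogonal projection onto the $\theta$-eigenspace), put $U_X(t)=\exp(itA)$. One always has $|U_X(t)_{v,u}|\le\sum_\theta|(E_\theta)_{v,u}|$. $X$ admits peak state transfer from $u$ to $v$ at time $\tau$ if $|U_X(\tau)_{v,u}|=\sum_\theta|(E_\theta)_{v,u}|$; the amount of the transfer is then $|U_X(\tau)_{v,u}|^2$. A graph $Y$ is periodic at a vertex $y$ at time $\tau$ if $|U_Y(\tau)_{y,y}|=1$. The Cartesian product $X\square Y$ has vertex set $V(X)\times V(Y)$ and adjacency matrix $A_X\otimes I+I\otimes A_Y$. *)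

(* Defs.v *)
From HB Require Import structures.
From mathcomp Require Import all_boot all_order all_algebra.
From mathcomp Require Import complex.
From mathcomp Require Import all_classical all_reals all_analysis.
Set Implicit Arguments.
Unset Strict Implicit.
Unset Printing Implicit Defensive.
Import Order.TTheory GRing.Theory Num.Theory.
Import numFieldNormedType.Exports.
Local Open Scope classical_set_scope.
Local Open Scope ring_scope.
Local Open Scope complex_scope.

Record sgraph := SGraph {
  vertex :> finType;
  edge : rel vertex;
  edge_sym : symmetric edge;
  edge_irr : irreflexive edge
}.

Section CartesianProduct.
Variables X Y : sgraph.

Definition cart_edge : rel (X * Y)%type := fun p q =>
  (edge p.1 q.1 && (p.2 == q.2)) || ((p.1 == q.1) && edge p.2 q.2).

Fact cart_edge_sym : symmetric cart_edge.
Proof.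
move=> p q; rewrite /cart_edge (edge_sym p.1) (edge_sym p.2).
by rewrite (eq_sym p.1) (eq_sym p.2).
Qed.

Fact cart_edge_irr : irreflexive cart_edge.
Proof. by move=> p; rewrite /cart_edge !edge_irr andbF. Qed.

Definition cartesian_product : sgraph :=
  @SGraph (X * Y)%type cart_edge cart_edge_sym cart_edge_irr.

End CartesianProduct.

(* Matrices of X are indexed by 'I_#|X|, vertices being numbered by enum_rank. *)
Definition entry (T : Type) (X : finType) (M : 'M[T]_#|X|) (x y : X) : T :=
  M (enum_rank x) (enum_rank y).

(* The limit is taken in the normed topology of 'M[K]_n (maximum norm). *)
Definition expmx (K : numFieldType) (n : nat) (M : 'M[K]_n) : 'M[K]_n :=
  lim (series (fun k => (k`!%:R)^-1 *: M ^+ k) @ \oo).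

Section WalkMatrix.
Variable R : realType.
Implicit Types X Y : sgraph.

Definition adjmx X : 'M[R[i]]_#|X| :=
  \matrix_(i, j) (edge (enum_val i) (enum_val j))%:R.

Definition transition_matrix X (t : R) : 'M[R[i]]_#|X| :=
  expmx (('i * t%:C) *: adjmx X).

Definition spectrum X : set R[i] := [set theta | eigenvalue (adjmx X) theta].

(* eigenspace and proj_ortho act on row vectors, proj_ortho being orthogonal
   for the standard Hermitian form; since adjmx X is real and symmetric, this
   is also the matrix of the projection acting on column vectors. *)
Definition eigenproj X (theta : R[i]) : 'M[R[i]]_#|X| :=
  proj_ortho (eigenspace (adjmx X) theta).

Definition peak_state_transfer X (u v : X) (tau : R) : Prop :=
  `|entry (transition_matrix X tau) v u| =
  \sum_(theta \in spectrum X) `|entry (eigenproj X theta) v u|.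

Definition transfer_amount X (u v : X) (tau : R) : R[i] :=
  `|entry (transition_matrix X tau) v u| ^+ 2.

Definition periodic_at X (x : X) (tau : R) : Prop :=
  `|entry (transition_matrix X tau) x x| = 1.

(* The adjacency matrix of the product is A_X (x) I + I (x) A_Y. *)
Lemma adjmx_cartesian_product X Y (x x' : X) (y y' : Y) :
  entry (adjmx (cartesian_product X Y)) (x, y) (x', y') =
  entry (adjmx X) x x' * entry 1%:M y y'
  + entry 1%:M x x' * entry (adjmx Y) y y'.
Proof.
rewrite /entry !mxE !enum_rankK /= /cart_edge /=.
rewrite !(inj_eq enum_rank_inj).
case: (eqVneq x x') => [<-|_]; case: (eqVneq y y') => [<-|_];
  by rewrite ?edge_irr ?andbT ?andbF ?orbF /= ?(mulr0, mul0r, mulr1, mul1r, addr0, add0r).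
Qed.

End WalkMatrix.

(* Main.v *)
Require Import Defs.
From mathcomp Require Import all_boot all_order all_algebra.
From mathcomp Require Import complex ring sesquilinear.
From mathcomp Require Import all_classical all_reals all_analysis.
Set Implicit Arguments.
Unset Strict Implicit.
Unset Printing Implicit Defensive.
Import Order.TTheory GRing.Theory Num.Theory.
Import numFieldNormedType.Exports.
Local Open Scope classical_set_scope.
Local Open Scope ring_scope.
Local Open Scope complex_scope.

(* Write S_X for the sum of the |(E_theta)_{v,u}| over the eigenvalues of X,
   and S for the analogous sum for X [] Y at ((v,y),(u,y)).  If A_X = sum
   theta E_theta and A_Y = sum mu F_mu, the eigenprojection of X [] Y for
   lambda is the sum of the E_theta (x) F_mu with theta + mu = lambda; as the
   (F_mu)_{y,y} are nonnegative and sum to 1, this gives S <= S_X.  On the other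
   hand U_{X [] Y} = U_X (x) U_Y, so that peak state transfer and periodicity
   yield S_X = |U_X(v,u)| |U_Y(y,y)| = |U_{X [] Y}| <= S, the last step being
   the general upper bound.  Hence all of these are equal; no analysis of the
   phases of the eigenprojections is needed. *)

(** * Spectral resolutions of Hermitian matrices *)

Section SpectralResolution.
Variable C : numClosedFieldType.
Local Notation "M ^*t" := (map_mx Num.conj M^T) (at level 30).

(* The values of lam may repeat, so that the products of two spectral
   resolutions form one for the Cartesian product, indexed by pairs. *)
Record resolution (n : nat) (A : 'M[C]_n) (I : finType) (lam : I -> C)
    (P : I -> 'M[C]_n) : Prop := Resolution {
  resolution_real : forall i, lam i \is Num.real;
  resolution_herm : forall i, (P i)^*t = P i;
  resolution_mul : forall i j, P i *m P j = if i == j then P i else 0;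
  resolution_sum : \sum_i P i = 1%:M;
  resolution_eq : A = \sum_i lam i *: P i }.

(** The spectral theorem gives a unitary [U] diagonalizing [A]; its rows are orthonormal, so the
    rank-one projections onto them form a resolution. *)
Lemma resolution_exists n (A : 'M[C]_n) : A \is hermsymmx ->
  exists (lam : 'I_n -> C) (P : 'I_n -> 'M[C]_n), resolution A lam P.
Proof.
move=> Ah; have [Un Uu] := (spectral_unitarymx A, spectral_unit A).
have /orthomx_spectralP := hermitian_normalmx Ah.
rewrite invmx_unitary //; set U := spectralmx A in Un Uu *.
set d := spectral_diag A => A_eq.
have dE i j : row i U *m (row j U)^*t = (i == j)%:R%:M.
  have /unitarymxP/matrixP/(_ i j) := Un; rewrite [RHS]mxE => <-.
  rewrite [LHS]mx11_scalar; congr (_%:M); rewrite !mxE.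
  by apply: eq_bigr => k _; rewrite !mxE.
have UE : U^*t *m U = 1%:M by exact: mulmx1C (unitarymxP Un).
exists (d 0), (fun i => (row i U)^*t *m row i U); split.
- by move=> i; have /mxOverP := hermitian_spectral_diag_real Ah; apply.
- by move=> i; rewrite trmx_mul map_mxM trmxCK.
- move=> i j; rewrite mulmxA -[X in X *m _]mulmxA dE mul_mx_scalar.
  case: eqVneq => [->|_]; first by rewrite scale1r.
  by rewrite scale0r mul0mx.
- rewrite -UE; apply/matrixP => a b; rewrite summxE !mxE.
  by apply: eq_bigr => k _; rewrite !mxE big_ord1 !mxE.
- rewrite A_eq; apply/matrixP => a b; rewrite summxE !mxE.
  apply: eq_bigr => k _; rewrite !mxE big_ord1 !mxE (bigD1 k) //= big1.
    by rewrite !mxE eqxx mulr1n addr0; ring.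
  by move=> j /negPf jk; rewrite !mxE jk mulr0.
Qed.

(** Distinct fibres of [h] are disjoint, so the sums over fibres remain mutually orthogonal
    projections; [lam] is constant on each fibre, so [A] is still recovered. *)
Lemma resolution_coarsen n (A : 'M[C]_n) (I J : finType) (lam : I -> C)
    (mu : J -> C) (h : I -> J) P :
  (forall j, mu j \is Num.real) -> (forall i, mu (h i) = lam i) ->
  resolution A lam P ->
  resolution A mu (fun j => \sum_(i | h i == j) P i).
Proof.
move=> mu_real muh [_ Ph Pm Ps AE]; split=> //.
- move=> j; rewrite raddf_sum map_mx_sum; apply: eq_bigr => i _; exact: Ph.
- move=> j k; rewrite mulmx_suml.
  have PkE i :
      P i *m (\sum_(i' | h i' == k) P i') = if h i == k then P i else 0.
    rewrite mulmx_sumr; case: ifP => hi.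
      rewrite (bigD1 i) //= Pm eqxx big1 ?addr0 // => l /andP[_ /negPf li].
      by rewrite Pm eq_sym li.
    rewrite big1 // => l hl; rewrite Pm; case: eqP => // il.
    by rewrite -il hi in hl.
  under eq_bigr do rewrite PkE.
  case: eqVneq => [->|jk]; first by apply: eq_bigr => i ->.
  by apply: big1 => i /eqP->; rewrite (negPf jk).
- by rewrite -Ps (partition_big h predT).
- rewrite AE (partition_big h predT) //=; apply: eq_bigr => j _.
  by rewrite scaler_sumr; apply: eq_bigr => i /eqP<-; rewrite muh.
Qed.

(** Merge the projections that share a value of [lam]. The norm bound is the triangle inequality
    within each merged block. *)
Lemma resolution_injective n (A : 'M[C]_n) (I : finType) (lam : I -> C) P :
  resolution A lam P ->
  exists (J : finType) (mu : J -> C) (Q : J -> 'M[C]_n),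
    [/\ injective mu, resolution A mu Q &
        forall a b, \sum_j `|Q j a b| <= \sum_i `|P i a b|].
Proof.
move=> Pres; pose J : finType := seq_sub (codom lam).
pose h i : J := SeqSub (codom_f lam i).
exists J, (fun j => ssval j), (fun j => \sum_(i | h i == j) P i); split.
- exact: val_inj.
- apply: (resolution_coarsen (h := h) _ _ Pres) => //.
  case=> /= x /codomP[i ->]; exact: resolution_real Pres i.
- move=> a b; rewrite [leRHS](partition_big h predT) //=.
  by apply: ler_sum => j _; rewrite summxE; exact: ler_norm_sum.
Qed.

Lemma resolution_expr n (A : 'M[C]_n) (I : finType) (lam : I -> C) P c k :
  resolution A lam P -> (c *: A) ^+ k = \sum_i (c * lam i) ^+ k *: P i.
Proof.
move=> [_ _ Pm Ps ->]; elim: k => [|k IH].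
  rewrite expr0 -[LHS]/(1%:M) -Ps.
  by apply: eq_bigr => i _; rewrite expr0 scale1r.
rewrite exprS IH -[_ * _]/(_ *m _) scaler_sumr mulmx_suml.
apply: eq_bigr => i _; rewrite mulmx_sumr (bigD1 i) //= big1 => [|j /negPf ji].
  by rewrite addr0 scalerA -scalemxAl -scalemxAr Pm eqxx scalerA exprS.
by rewrite scalerA -scalemxAl -scalemxAr Pm eq_sym ji !scaler0.
Qed.

(* With Q the right-hand side, Q lies in the eigenspace and 1 - Q is orthogonal
   to it, so the projection maps 1 = Q + (1 - Q) to Q. *)
Lemma proj_ortho_eigenspace n (A : 'M[C]_n) (I : finType) (lam : I -> C) P th :
  resolution A lam P ->
  proj_ortho (eigenspace A th) = \sum_(i | lam i == th) P i.
Proof.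
move=> [_ Ph Pm Ps AE]; set Q := \sum_(i | _) _.
have PA i : P i *m A = lam i *: P i.
  rewrite AE mulmx_sumr (bigD1 i) //= -scalemxAr Pm eqxx big1 ?addr0 //.
  by move=> j /negPf ji; rewrite -scalemxAr Pm eq_sym ji scaler0.
have AP i : A *m P i = lam i *: P i.
  rewrite AE mulmx_suml (bigD1 i) //= -scalemxAl Pm eqxx big1 ?addr0 //.
  by move=> j /negPf ji; rewrite -scalemxAl Pm ji scaler0.
have Qsub : (Q <= eigenspace A th)%MS.
  apply/eigenspaceP; rewrite mulmx_suml scaler_sumr.
  by apply: eq_bigr => i /eqP <-.
have Qh : Q^*t = Q.
  by rewrite raddf_sum map_mx_sum; apply: eq_bigr => i _; exact: Ph.
have QU : eigenspace A th *m Q = eigenspace A th.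
  set W := eigenspace A th; have /eigenspaceP WA : (W <= W)%MS by [].
  rewrite -[RHS]mulmx1 -Ps (bigID (fun i => lam i == th)) /= mulmxDr.
  rewrite [X in _ + X]mulmx_sumr.
  rewrite [X in _ + X]big1 ?addr0 // => i lamth.
  (* [W *m A *m P i] is [th *: (W *m P i)] when read from the left and [lam i *: (W *m P i)] when
     read from the right. *)
  have /eqP : (lam i - th) *: (W *m P i) = 0.
    by rewrite scalerBl scalemxAr -AP mulmxA WA -scalemxAl subrr.
  by rewrite scaler_eq0 subr_eq0 (negPf lamth) => /eqP.
set E := proj_ortho _.
rewrite -[E]mul1mx -[1%:M](subrK Q) mulmxDl (proj_ortho_id Qsub).
rewrite proj_ortho_0 ?add0r //; apply/orthomx1P.
(* The adjoint of [W *m Q = W] says that [1 - Q] kills [W^*t], which is the required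
   orthogonality. *)
have /(congr1 (fun M => M^*t)) := QU; rewrite trmx_mul map_mxM Qh => QWE.
by rewrite mulmxBl mul1mx QWE subrr.
Qed.

(** The sum over the set of eigenvalues is turned into a sum over [codom lam]: values that are not
    eigenvalues contribute 0, and an eigenvalue outside [codom lam] would have a zero projection,
    hence a zero eigenspace. Injectivity then leaves a single [P i] for each value. *)
Lemma fsum_norm_eigenprojection n (A : 'M[C]_n) (I : finType) (lam : I -> C) P
    a b : injective lam -> resolution A lam P ->
  \sum_(th \in [set th | eigenvalue A th])
    `|proj_ortho (eigenspace A th) a b| = \sum_i `|P i a b|.
Proof.
move=> lam_inj Pres.
have E0 th : ~~ eigenvalue A th -> proj_ortho (eigenspace A th) = 0.
  rewrite negbK => /eqP ->; apply/eqP; rewrite -submx0.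
  by rewrite proj_orthoE submx0.
rewrite (fsbig_widen _ [set` codom lam]); first last.
- by move=> th [_ /= /negP nev]; rewrite E0 // mxE normr0.
- move=> th /= ev; apply/negPn/negP => thN.
  have := proj_orthoE (eigenspace A th).
  rewrite (proj_ortho_eigenspace th Pres) big_pred0 => [E|i].
    move: ev; rewrite /eigenvalue -submx0 -E submx0 eqxx //.
  by apply: contraNF thN => /eqP <-; exact: codom_f.
rewrite -fsbig_seq; last by apply/injectiveP.
rewrite codomE big_map big_enum /=; apply: eq_bigr => i _.
by rewrite (proj_ortho_eigenspace _ Pres) (big_pred1 i) // => j; exact: inj_eq.
Qed.

(** As [P i] equals [P i *m (P i)^*t], its diagonal entries are sums of squared moduli. *)
Lemma resolution_diag_ge0 n (A : 'M[C]_n) (I : finType) (lam : I -> C) P i a :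
  resolution A lam P -> 0 <= P i a a.
Proof.
move=> [_ Ph Pm _ _]; have := Pm i i; rewrite eqxx => <-.
rewrite mxE; apply: sumr_ge0 => k _; rewrite -{2}(Ph i) !mxE.
exact: mul_conjC_ge0.
Qed.

Lemma resolution_sum_norm_diag n (A : 'M[C]_n) (I : finType) (lam : I -> C) P
    a : resolution A lam P -> \sum_i `|P i a a| = 1.
Proof.
move=> Pres; have /matrixP/(_ a a) := resolution_sum Pres.
rewrite summxE mxE eqxx mulr1n => <-; apply: eq_bigr => i _.
by apply: ger0_norm; exact: resolution_diag_ge0 Pres.
Qed.

(** Each partial sum of the matrix series is the combination of the [P i] with the scalar partial
    sums as coefficients, and a finite sum commutes with the limit. *)
Lemma expmx_resolution n (A : 'M[C]_n) (I : finType) (lam e : I -> C) P c :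
  resolution A lam P ->
  (forall i, series (fun k => (k`!%:R)^-1 * (c * lam i) ^+ k) @ \oo --> e i) ->
  expmx (c *: A) = \sum_i e i *: P i.
Proof.
move=> Pres ecvg; apply: cvg_lim => //.
rewrite [X in X @ \oo](_ : _ = fun N => \sum_i
    series (fun k => (k`!%:R)^-1 * (c * lam i) ^+ k) N *: P i); last first.
  apply/funext => N; rewrite /series /=.
  under eq_bigr do rewrite (resolution_expr _ _ Pres) scaler_sumr.
  rewrite exchange_big; apply: eq_bigr => i _.
  by rewrite scaler_suml; apply: eq_bigr => k _; rewrite scalerA.
apply: (@cvg_big _ _ +%R) => [|i _]; first exact: add_continuous.
exact: cvgZr_tmp.
Qed.

End SpectralResolution.

(** * The exponential series at an imaginary argument *)

Section ComplexExponential.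
Variables (R : realType) (x : R).
Local Notation C := (R[i] : numClosedFieldType).

(** The power ['i ^+ k] is a sign, times ['i] when [k] is odd; hence each term is purely real or
    purely imaginary according to the parity of [k]. *)
Lemma exp_coeff_imaginary k :
  (k`!%:R)^-1 * ('i * x%:C) ^+ k = cos_coeff x k +i* sin_coeff x k :> C.
Proof.
rewrite exprMn -complexiE.
have -> : ('i%C : C) ^+ k = if odd k then 'i%C * (-1) ^+ k./2 else (-1) ^+ k./2.
  rewrite -[in LHS](odd_double_half k) exprD -mul2n exprM sqr_i.
  by case: (odd k); rewrite ?expr1 // expr0 mul1r.
have -> : (k`!%:R : C)^-1 = ((k`!%:R)^-1)%:C by rewrite fmorphV rmorph_nat.
have -> : (-1 : C) ^+ k./2 = ((-1) ^+ k./2)%:C.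
  by rewrite rmorphXn rmorphN1.
rewrite -rmorphXn /cos_coeff /sin_coeff.
rewrite /= -exprnP; case: (boolP (odd k)) => oddk /=.
  have -> : k.-1./2 = k./2.
    by case: k oddk => // k /= /negPf oddk; rewrite uphalf_half oddk.
  by apply/eqP; rewrite eq_complex /=; apply/andP; split; apply/eqP; ring.
apply/eqP; rewrite eq_complex /=.
by apply/andP; split; apply/eqP; ring.
Qed.

Lemma cvg_series_exp_imaginary :
  series (fun k => (k`!%:R)^-1 * ('i * x%:C) ^+ k : C) @ \oo -->
    (cos x +i* sin x : C).
Proof.
have -> : series (fun k => (k`!%:R)^-1 * ('i * x%:C) ^+ k : C) =
    fun N => series (cos_coeff x) N +i* series (sin_coeff x) N.
  apply/funext => N; rewrite /series /=.
  under eq_bigr do rewrite exp_coeff_imaginary.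
  elim: N => [|N IH]; first by rewrite !big_geq.
  by rewrite !big_nat_recr //= IH.
apply/cvgrPdist_le => e e0.
(* A positive [e] in [R[i]] is real, so it splits into two equal real tolerances, one for the cosine
   series and one for the sine series. *)
have [d dE] : exists d : R, e = (d%:C + d%:C).
  exists (complex.Re e / 2).
  by rewrite -rmorphD /= -splitr RRe_real // gtr0_real.
have d0 : 0 < d.
  by move: e0; rewrite dE -rmorphD ltcR -mulr2n pmulrn_lgt0.
have /cvgrPdist_le/(_ d d0) ccos : series (cos_coeff x) @ \oo --> cos x.
  rewrite unlock; exact: is_cvg_series_cos_coeff.
have /cvgrPdist_le/(_ d d0) csin : series (sin_coeff x) @ \oo --> sin x.
  rewrite unlock; exact: is_cvg_series_sin_coeff.
near=> N.
rewrite [X in `|X|]complexE dE /=.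
apply: le_trans (ler_normD _ _) _; rewrite normrM.
rewrite complexiE normCi mul1r.
have normR (r : R) : `|r%:C| = `|r|%:C.
  by rewrite normc_def /= expr0n addr0 sqrtr_sqr.
by rewrite !normR; apply: lerD; rewrite lecR; near: N.
Unshelve. all: by end_near. Qed.

Lemma norm_exp_imaginary : `|cos x +i* sin x : C| = 1.
Proof. by rewrite normc_def /= cos2Dsin2 sqrtr1. Qed.

End ComplexExponential.

(** * Kronecker products of matrices indexed by finite types *)

Section Kronecker.
Variable T : comPzRingType.
Implicit Types X Y : finType.

Lemma entry_inj X (M N : 'M[T]_#|X|) :
  (forall x x', entry M x x' = entry N x x') -> M = N.
Proof.
move=> MN; apply/matrixP => i j.
by have := MN (enum_val i) (enum_val j); rewrite /entry !enum_valK.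
Qed.

Lemma entry_mul X (M N : 'M[T]_#|X|) x x' :
  entry (M *m N) x x' = \sum_z entry M x z * entry N z x'.
Proof.
rewrite /entry mxE (reindex_onto (@enum_rank X) enum_val) => [|i _].
  by apply: eq_bigl => z; rewrite enum_rankK eqxx.
by rewrite enum_valK.
Qed.

Lemma entry_sum X (I : Type) (r : seq I) (P : pred I) (F : I -> 'M[T]_#|X|)
    x x' :
  entry (\sum_(i <- r | P i) F i) x x' = \sum_(i <- r | P i) entry (F i) x x'.
Proof. exact: summxE. Qed.

Lemma entry_scale X c (M : 'M[T]_#|X|) x x' :
  entry (c *: M) x x' = c * entry M x x'.
Proof. exact: mxE. Qed.

Lemma entry1 X x x' : entry (1%:M : 'M[T]_#|X|) x x' = (x == x')%:R.
Proof. by rewrite /entry mxE (inj_eq enum_rank_inj). Qed.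

(** The Kronecker product, indexed through the enumeration of [X * Y] so that it has the same type
    as the matrices of the product graph. *)
Definition kron X Y (M : 'M[T]_#|X|) (N : 'M[T]_#|Y|) : 'M[T]_#|{: X * Y}| :=
  \matrix_(i, j) (entry M (enum_val i).1 (enum_val j).1 *
                  entry N (enum_val i).2 (enum_val j).2).

Lemma entry_kron X Y (M : 'M[T]_#|X|) (N : 'M[T]_#|Y|) p q :
  entry (kron M N) p q = entry M p.1 q.1 * entry N p.2 q.2.
Proof. by rewrite /entry mxE !enum_rankK. Qed.

Lemma kron_mul X Y (M M' : 'M[T]_#|X|) (N N' : 'M[T]_#|Y|) :
  kron M N *m kron M' N' = kron (M *m M') (N *m N').
Proof.
apply: entry_inj => p q; rewrite entry_mul entry_kron !entry_mul.
rewrite big_distrlr /= pair_big /=.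
by apply: eq_bigr => -[z w] _; rewrite !entry_kron /=; ring.
Qed.

Lemma kron_sum X Y (I J : finType) (F : I -> 'M[T]_#|X|) (G : J -> 'M[T]_#|Y|) :
  kron (\sum_i F i) (\sum_j G j) = \sum_p kron (F p.1) (G p.2).
Proof.
apply: entry_inj => p q; rewrite entry_kron !entry_sum big_distrlr /= pair_big.
by apply: eq_bigr => r _; rewrite entry_kron.
Qed.

Lemma kron11 X Y : kron (1%:M : 'M[T]_#|X|) (1%:M : 'M[T]_#|Y|) = 1%:M.
Proof.
by apply: entry_inj => -[x y] [x' y']; rewrite entry_kron !entry1 -natrM mulnb.
Qed.

Lemma kron0l X Y (N : 'M[T]_#|Y|) : kron (0 : 'M[T]_#|X|) N = 0.
Proof. by apply/matrixP => i j; rewrite !mxE /entry mxE mul0r. Qed.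

Lemma kron0r X Y (M : 'M[T]_#|X|) : kron M (0 : 'M[T]_#|Y|) = 0.
Proof. by apply/matrixP => i j; rewrite !mxE /entry mxE mulr0. Qed.

End Kronecker.

(** * Transition matrices and eigenprojections of graphs *)

Section Graphs.
Variable R : realType.
Local Notation C := (R[i] : numClosedFieldType).
Implicit Types X Y : sgraph.

Lemma adjmx_hermitian X : (adjmx R X : 'M[C]_#|X|) \is hermsymmx.
Proof.
apply: realsym_hermsym.
  apply/is_hermitianmxP; rewrite expr0 scale1r.
  by apply/matrixP => i j; rewrite !mxE edge_sym.
by apply/mxOverP => i j; rewrite mxE realn.
Qed.

(** In [A (x) I + I (x) B], both identities are expanded as the sums of the [P i] and of the [Q j],
    so that each [P i (x) Q j] receives the coefficient [lam i + mu j]. *)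
Lemma resolution_cartesian_product X Y (I J : finType) (lam : I -> C)
    (mu : J -> C) (P : I -> 'M[C]_#|X|) (Q : J -> 'M[C]_#|Y|) :
  resolution (adjmx R X) lam P -> resolution (adjmx R Y) mu Q ->
  @resolution C _ (adjmx R (cartesian_product X Y)) _
    (fun p : I * J => lam p.1 + mu p.2) (fun p => kron (P p.1) (Q p.2)).
Proof.
move=> [lr Ph Pm Ps AE] [mr Qh Qm Qs BE]; split.
- by move=> p; rewrite realD.
- move=> [i j]; apply/matrixP => a b.
  by rewrite !mxE rmorphM -[in RHS]Ph -[in RHS]Qh /entry !mxE.
- move=> [i j] [i' j'] /=; rewrite kron_mul Pm Qm xpair_eqE.
  by case: eqP => _ /=; [case: eqP => _; rewrite ?kron0r|rewrite kron0l].
- by rewrite -kron_sum Ps Qs kron11.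
- apply: entry_inj => -[x y] [x' y'].
  rewrite adjmx_cartesian_product AE BE -Ps -Qs !entry_sum !big_distrlr /=.
  rewrite !pair_big -big_split /=; apply: eq_bigr => p _.
  by rewrite !entry_scale entry_kron /=; ring.
Qed.

Lemma transition_matrix_resolution X (I : finType) (lam : I -> C) P t :
  resolution (adjmx R X) lam P ->
  transition_matrix X t =
  \sum_i (cos (t * complex.Re (lam i)) +i* sin (t * complex.Re (lam i))) *: P i.
Proof.
move=> Pres; apply: (expmx_resolution Pres) => i.
(* The values [lam i] are real, so the exponent is ['i] times an embedded real number. *)
rewrite -mulrA -[in X in series X](RRe_real (resolution_real Pres i)) -rmorphM.
exact: cvg_series_exp_imaginary.
Qed.

(** The phase at [lam i + mu j] is the product of the two phases by the addition formulas for [cos]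
    and [sin], so the double sum factors. *)
Lemma transition_matrix_cartesian_product X Y t (x x' : X) (y y' : Y) :
  entry (transition_matrix (cartesian_product X Y) t) (x, y) (x', y') =
  entry (transition_matrix X t) x x' * entry (transition_matrix Y t) y y' :> C.
Proof.
have [lam [P Pres]] := resolution_exists (adjmx_hermitian X).
have [mu [Q Qres]] := resolution_exists (adjmx_hermitian Y).
rewrite (transition_matrix_resolution _ Pres).
rewrite (transition_matrix_resolution _ Qres).
have XYres := resolution_cartesian_product Pres Qres.
rewrite (transition_matrix_resolution _ XYres).
rewrite !entry_sum big_distrlr pair_big; apply: eq_bigr => -[i j] _ /=.
rewrite !entry_scale entry_kron /= mulrACA; congr (_ * _).
rewrite raddfD /= mulrDr cosD sinD; apply/eqP; rewrite eq_complex /=.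
by apply/andP; split; apply/eqP; ring.
Qed.

Lemma sum_norm_eigenproj X (I : finType) (lam : I -> C) P u v :
  injective lam -> resolution (adjmx R X) lam P ->
  \sum_(theta \in @spectrum R X) `|entry (eigenproj X theta) v u| =
  \sum_i `|entry (P i) v u|.
Proof. exact: fsum_norm_eigenprojection. Qed.

(** This form allows repeated values of [lam], as happens for sums of eigenvalues of two factors. *)
Lemma sum_norm_eigenproj_le X (I : finType) (lam : I -> C) P u v :
  resolution (adjmx R X) lam P ->
  \sum_(theta \in @spectrum R X) `|entry (eigenproj X theta) v u| <=
  \sum_i `|entry (P i) v u|.
Proof.
move=> /resolution_injective[J [mu [Q [mu_inj Qres QP]]]].
rewrite (sum_norm_eigenproj _ _ mu_inj Qres); exact: QP.
Qed.

(** Triangle inequality, the phases having modulus 1. *)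
Lemma norm_transition_matrix_le X t (u v : X) :
  `|entry (transition_matrix X t) v u| <=
  \sum_(theta \in @spectrum R X) `|entry (eigenproj X theta) v u|.
Proof.
have [? [? /resolution_injective]] := resolution_exists (adjmx_hermitian X).
move=> [J [mu [Q [mu_inj Qres _]]]].
rewrite (sum_norm_eigenproj _ _ mu_inj Qres).
rewrite (transition_matrix_resolution _ Qres) entry_sum.
apply: le_trans (ler_norm_sum _ _ _) _; apply: ler_sum => j _.
by rewrite entry_scale normrM norm_exp_imaginary mul1r.
Qed.

Lemma sum_norm_eigenproj_cartesian_product_le X Y (u v : X) (y : Y) :
  \sum_(theta \in @spectrum R (cartesian_product X Y))
     `|entry (eigenproj (cartesian_product X Y) theta) (v, y) (u, y)| <=
  \sum_(theta \in @spectrum R X) `|entry (eigenproj X theta) v u|.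
Proof.
have [? [? /resolution_injective]] := resolution_exists (adjmx_hermitian X).
move=> [I [lam [P [lam_inj Pres _]]]].
have [mu [Q Qres]] := resolution_exists (adjmx_hermitian Y).
have XYres := resolution_cartesian_product Pres Qres.
apply: le_trans
  (@sum_norm_eigenproj_le (cartesian_product X Y) _ _ _ _ _ XYres) _.
rewrite (sum_norm_eigenproj _ _ lam_inj Pres).
(* The factor 1 is the total weight of the diagonal entries of the [Q j] at [y]; multiplying it out
   gives exactly the sum over pairs. *)
rewrite -[leRHS]mulr1 -(resolution_sum_norm_diag (enum_rank y) Qres).
rewrite big_distrlr pair_big le_eqVlt; apply/orP; left; apply/eqP.
by apply: eq_bigr => p _; rewrite entry_kron normrM.
Qed.

End Graphs.

Theorem lemma7p1 (R : realType) (X Y : sgraph) (u v : X) (y : Y)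
    (tau alpha : R) :
  peak_state_transfer u v tau ->
  transfer_amount u v tau = alpha%:C ->
  periodic_at y tau ->
  peak_state_transfer (X := cartesian_product X Y) (u, y) (v, y) tau /\
  transfer_amount (X := cartesian_product X Y) (u, y) (v, y) tau = alpha%:C.
Proof.
move=> peak amount per.
have normU : `|entry (transition_matrix (cartesian_product X Y) tau)
                 (v, y) (u, y)| = `|entry (transition_matrix X tau) v u|.
  rewrite transition_matrix_cartesian_product normrM.
  by rewrite [X in _ * X]per mulr1.
split; last by rewrite /transfer_amount normU.
(* One inequality is the general bound for the product; by [normU] and [peak], the other compares
   the eigenprojection sums of the product and of [X]. *)
apply: le_anti; rewrite norm_transition_matrix_le /= normU peak.
exact: sum_norm_eigenproj_cartesian_product_le.
Qed.
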